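(* Let $\pi=\{p_1,\ldots,p_n\}$ be a finite set of primes and let $G$ be a finite group. Suppose that $G$ has four meta-$\pi$-special subgroups $A_1,A_2,A_3,A_4$ whose indices $|G:A_1|,|G:A_2|,|G:A_3|,|G:A_4|$ are pairwise coprime and each of them is either a $\pi$-number or a $\pi'$-number. Suppose also that at most one of the numbers $|G:A_1|,|G:A_2|,|G:A_3|,|G:A_4|$ is a $\pi'$-number. Then $G$ is meta-$\pi$-special.
   Context: All groups are finite. $\pi'$ is the set of primes not in $\pi$. A $\pi$-number (respectively $\pi'$-number) is a positive integer all of whose prime divisors lie in $\pi$ (respectively $\pi'$). A group $G$ is $\pi$-special if $G=O_{p_1}(G)\times\cdots\times O_{p_n}(G)\times O_{\pi'}(G)$. A group is meta-$\pi$-special if it is an extension of a $\pi$-special group by a $\pi$-special group, i.e. it has a $\pi$-special normal subgroup with $\pi$-special quotient. *)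

(* Defs.v *)
From mathcomp Require Import all_boot all_fingroup all_solvable.

Set Implicit Arguments.
Unset Strict Implicit.
Unset Printing Implicit Defensive.

Import GroupScope.

Definition prime_set (s : seq nat) : nat_pred := [pred p in s].

(* The internal direct product [\x] carries its side conditions: the equation
   can only hold if the factors commute and form a direct product. The list s
   is meant to be duplicate-free. *)
Definition pi_special (s : seq nat) (gT : finGroupType) (G : {group gT}) : Prop :=
  (\big[dprod/1]_(p <- s) 'O_p(G)) \x 'O_(prime_set s)^'(G) = G.

Definition meta_pi_special (s : seq nat) (gT : finGroupType) (G : {group gT}) :
    Prop :=
  exists N : {group gT}, [/\ N <| G, pi_special s N & pi_special s (G / N)%G].

(* Main.v *)
Require Import Defs.
From mathcomp Require Import all_boot all_fingroup all_solvable.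

(* Let sigma be the partition of the primes into the singletons {p_1}, ...,
   {p_n} and the block pi'. Then pi-special means sigma-nilpotent: for every
   block there is a normal Hall subgroup. The hypotheses on the indices say
   that every block is involved in at most one of them.

   G is sigma-soluble by Wielandt's argument. Fix a block b and factor out
   Q = O_b'(G); then V = O_b(G) contains its centralizer in G. If the index of
   A is a b'-number then A contains V, so no normal b'-subgroup of A but 1
   centralizes V; this makes the normal sigma-nilpotent subgroup N of A a
   b-group, so A has a normal Hall b-subgroup. Two such A's of coprime index
   have the same normal Hall b-subgroup, which is therefore normal in G and
   equal to V. Each A/V is sigma-nilpotent, and for any further block two of
   the three available A's have index prime to it, so the same argument shows
   that G/V is sigma-nilpotent. Let L_b be the preimage of V in G. Then the
   intersection F of the L_b over all b has G/F sigma-nilpotent, and F is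
   sigma-nilpotent because each L_b, hence F, has a normal Hall b'-subgroup. *)

Set Implicit Arguments.
Unset Strict Implicit.
Unset Printing Implicit Defensive.

Import GroupScope.

(** * Sigma-notions for a colouring of the primes *)

(* The partition sigma of the primes is encoded by a colouring [c]; its blocks
   are the colour classes. *)
Definition block (c : nat -> nat) (i : nat) : nat_pred := [pred p | c p == i].

(* [G / M] has a normal Hall pi-subgroup, stated through indices so as to stay
   in [gT]. *)
Definition nhall (pi : nat_pred) (gT : finGroupType) (G M : {set gT}) : Prop :=
  exists K : {group gT},
    [/\ K <| G, M \subset K, pi.-nat #|K : M| & pi^'.-nat #|G : K|].

Definition sigma_nilpotent c (gT : finGroupType) (G M : {set gT}) : Prop :=
  forall i, nhall (block c i) G M.

Definition sigma_metanilpotent c (gT : finGroupType) (G : {set gT}) : Prop :=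
  exists N : {group gT},
    [/\ N <| G, sigma_nilpotent c N 1 & sigma_nilpotent c G N].

(* Quantifying over all sections [H / K], rather than over a series, makes the
   property visibly hereditary. *)
Definition sigma_soluble c (gT : finGroupType) (G : {set gT}) : Prop :=
  forall H K : {group gT}, H \subset G -> K <| H -> K \proper H ->
  exists i, exists L : {group gT},
    [/\ L <| H, K \proper L & (block c i).-nat #|L : K|].

(** For a singleton block this is coprimality at one prime; for the block of all primes outside [s]
    it says that one of the two numbers has all its prime divisors in [s]. *)
Definition sigma_coprime c (m n : nat) : Prop :=
  forall i, (block c i)^'.-nat m \/ (block c i)^'.-nat n.

(** * Indices and normal Hall subgroups *)

(** [#|N : B|] is the index of the intersection in [N], hence that of [B] in [B * N]; the normality
    hypothesis makes this product a subgroup of [A]. *)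
Lemma dvdn_index_norm (gT : finGroupType) (A B N : {group gT}) :
  N \subset A -> B \subset A -> A \subset 'N(N) \/ A \subset 'N(B) ->
  #|N : B| %| #|A : B|.
Proof.
move=> sNA sBA nA.
have BN : B <*> N = B * N.
  case: nA => nA; first by rewrite norm_joinEl // (subset_trans sBA).
  by rewrite norm_joinEr // (subset_trans sNA).
rewrite -indexMg -BN; apply: indexSg; first exact: joing_subl.
by rewrite join_subG sBA.
Qed.

Lemma sub_coprime_index (pi : nat_pred) (gT : finGroupType)
    (A B N : {group gT}) :
  N \subset A -> B \subset A -> A \subset 'N(N) \/ A \subset 'N(B) ->
  pi.-nat #|N : B| -> pi^'.-nat #|A : B| -> N \subset B.
Proof.
move=> sNA sBA nA piN pi'A; rewrite -indexg_eq1.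
by rewrite (@pnat_1 pi #|N : B|) // (pnat_dvd _ pi'A) // dvdn_index_norm.
Qed.

Lemma pcore_normal_sub (pi : nat_pred) (gT : finGroupType)
    (G H : {group gT}) : H <| G -> 'O_pi(H) \subset 'O_pi(G).
Proof.
move=> nHG; apply: pcore_max; first exact: pcore_pgroup.
exact: gFnormal_trans.
Qed.

Lemma nhall_setI (pi : nat_pred) (gT : finGroupType) (G M1 M2 : {group gT}) :
  M1 <| G -> M2 <| G -> nhall pi G M1 -> nhall pi G M2 ->
  nhall pi G (M1 :&: M2).
Proof.
move=> nM1 nM2 [K1 [nK1 sM1 pK1 pG1]] [K2 [nK2 sM2 pK2 pG2]].
exists (K1 :&: K2)%G; split.
- exact: normalI.
- exact: setISS.
(* Refine through [K1 :&: M2]: the upper index divides [#|K2 : M2|], the lower one [#|K1 : M1|]. *)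
- rewrite -(@Lagrange_index _ (K1 :&: K2)%G (K1 :&: M2)%G (M1 :&: M2)%G) /=;
    [|exact: setIS|exact: setSI].
  rewrite pnatM; apply/andP; split.
    have -> : K1 :&: M2 = (K1 :&: K2) :&: M2 by rewrite -setIA (setIidPr sM2).
    rewrite indexgI; apply: pnat_dvd pK2; apply: dvdn_index_norm => //.
      exact: subsetIr.
    by right; apply: subset_trans (normal_norm nM2); apply: normal_sub.
  have -> : M1 :&: M2 = (K1 :&: M2) :&: M1.
    by rewrite setIAC (setIidPr sM1).
  rewrite indexgI; apply: pnat_dvd pK1; apply: dvdn_index_norm => //.
    exact: subsetIl.
  by right; apply: subset_trans (normal_norm nM1); apply: normal_sub.
rewrite -(@Lagrange_index _ G K1 (K1 :&: K2)%G) ?subsetIl ?(normal_sub nK1) //=.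
rewrite pnatM pG1 indexgI; apply: pnat_dvd pG2.
by apply: dvdn_index_norm; [apply: normal_sub..|left; apply: normal_norm].
Qed.

Lemma nhall_mono (pi : nat_pred) (gT : finGroupType) (G M V : {group gT}) :
  M \subset V -> V <| G -> nhall pi G M -> nhall pi G V.
Proof.
move=> sMV nV [K [nK sMK pK pG]]; exists (K <*> V)%G; split.
- exact: normalY.
- exact: joing_subr.
- rewrite /= joingC norm_joinEr; last first.
    by rewrite (subset_trans (normal_sub nK)) // normal_norm.
  by rewrite indexMg (pnat_dvd _ pK) // indexgS.
apply: pnat_dvd pG; apply: indexgS; exact: joing_subl.
Qed.

Lemma nhall_quotient (pi : nat_pred) (gT : finGroupType)
    (G M Q : {group gT}) :
  G \subset 'N(Q) -> nhall pi G M -> nhall pi (G / Q) (M / Q).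
Proof.
move=> nQ [K [nK sMK pK pG]]; exists (K / Q)%G.
have sKN : K \subset 'N(Q) by rewrite (subset_trans (normal_sub nK)).
split.
- exact: quotient_normal.
- exact: quotientS.
- apply: pnat_dvd pK; apply: index_quotient.
  by apply: subset_trans sKN; apply: subsetIl.
apply: pnat_dvd pG; apply: index_quotient.
by apply: subset_trans nQ; apply: subsetIl.
Qed.

Lemma nhall_cosetpre (pi : nat_pred) (gT : finGroupType) (G Q : {group gT})
    (M : {group coset_of Q}) :
  Q <| G -> nhall pi (G / Q) M -> nhall pi G (coset Q @*^-1 M).
Proof.
move=> nQ [K [nK sMK pK pG]]; exists (coset Q @*^-1 K)%G; split.
- by rewrite -(quotientGK nQ) cosetpre_normal.
- exact: morphpreS.
- by rewrite /= index_cosetpre.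
by rewrite /= -(quotientGK nQ) index_cosetpre.
Qed.

Lemma sigma_metanilpotent_quotient c (gT : finGroupType) (G Q : {group gT}) :
  G \subset 'N(Q) -> sigma_metanilpotent c G ->
  sigma_metanilpotent c (G / Q).
Proof.
move=> nQ [N [nN nil1 nil2]]; exists (N / Q)%G; split.
- exact: quotient_normal.
- move=> i; have := nil1 i => /(@nhall_quotient _ _ _ 1%G Q) /=.
  by rewrite quotient1; apply; rewrite (subset_trans (normal_sub nN)).
by move=> i; apply: nhall_quotient.
Qed.

(* A normal pi-Hall subgroup of [A1] has pi-index over its intersection with
   [A2], while [#|A1 : A1 :&: A2| = #|G : A2|] is a pi'-number: hence it lies
   in [A2], and by symmetry the normal Hall subgroups of [A1] and [A2] coincide
   and are normalised by [A1 * A2 = G]. *)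
Lemma nhall_coprime_index (pi : nat_pred) (gT : finGroupType)
    (G A1 A2 V : {group gT}) :
  A1 \subset G -> A2 \subset G -> coprime #|G : A1| #|G : A2| ->
  V \subset A1 -> V \subset A2 ->
  pi^'.-nat #|G : A1| -> pi^'.-nat #|G : A2| ->
  nhall pi A1 V -> nhall pi A2 V -> nhall pi G V.
Proof.
move=> sA1 sA2 co12 sV1 sV2 p1 p2 [K1 [nK1 sK1 pK1 pA1]] [K2 [nK2 sK2 pK2 pA2]].
have sub (B1 B2 L1 L2 : {group gT}) : B2 * B1 = G ->
    V \subset B2 -> pi^'.-nat #|G : B2| ->
    L1 <| B1 -> L2 <| B2 -> V \subset L1 -> V \subset L2 ->
    pi.-nat #|L1 : V| -> pi^'.-nat #|B2 : L2| -> L1 \subset L2.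
  move=> dG sB2 pB2 nL1 nL2 sL1 sL2 piL piB.
  have sL1B2 : L1 \subset B2.
    suff : L1 \subset B1 :&: B2 by rewrite subsetI => /andP[].
    apply: (@sub_coprime_index pi _ B1); rewrite ?subsetIl //.
    - exact: normal_sub.
    - by left; apply: normal_norm.
    - apply: pnat_dvd piL; apply: indexgS; rewrite subsetI sB2 andbT.
      exact: subset_trans sL1 (normal_sub nL1).
    by rewrite /= indexgI -indexMg dG.
  apply: (@sub_coprime_index pi _ B2) => //; first exact: normal_sub.
    by right; apply: normal_norm.
  by apply: pnat_dvd piL; apply: indexgS.
have defG := coprime_index_mulG sA1 sA2 co12.
have defG' : A2 * A1 = G by apply: coprime_index_mulG; rewrite // coprime_sym.
have eqK : K1 = K2.
  by apply/val_inj/eqP; rewrite eqEsubset (sub A1 A2) // (sub A2 A1).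
exists K1; split => //.
  rewrite /normal (subset_trans (normal_sub nK1)) //= -defG mul_subG //.
    exact: normal_norm.
  by rewrite eqK normal_norm.
by rewrite -(Lagrange_index sA1 (normal_sub nK1)) pnatM p1.
Qed.

(** * Closure properties of sigma-soluble groups *)

Lemma sigma_soluble_sub c (gT : finGroupType) (G H : {group gT}) :
  H \subset G -> sigma_soluble c G -> sigma_soluble c H.
Proof. by move=> sHG sol K L sKH; apply: sol; apply: subset_trans sHG. Qed.

Lemma sigma_soluble_quotient c (gT : finGroupType) (G Q : {group gT}) :
  G \subset 'N(Q) -> sigma_soluble c G -> sigma_soluble c (G / Q).
Proof.
move=> nQ sol H K sHG nKH pKH.
(* [Q] need not lie in [G], so preimages are cut down to [G]. *)
pose pre (R : {group coset_of Q}) := (G :&: coset Q @*^-1 R)%G.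
have preK (R : {group coset_of Q}) : R \subset G / Q -> pre R / Q = R.
  by move=> sRG; rewrite /= /quotient morphim_setIpre (setIidPr sRG).
have sKG : K \subset G / Q by apply: subset_trans sHG; apply: normal_sub.
have [||| i [L [nL pL bL]]] := sol (pre H) (pre K).
- exact: subsetIl.
- have nKH1 : coset Q @*^-1 K <| coset Q @*^-1 H by rewrite cosetpre_normal.
  apply/andP; split; first by apply: setIS; apply: normal_sub.
  apply: normsI; first by rewrite normsG ?subsetIl.
  exact: subset_trans (subsetIr _ _) (normal_norm nKH1).
- apply/andP; split; first exact: setIS (morphpreS _ (proper_sub pKH)).
  apply: contra (proper_subn pKH) => sHK.
  by rewrite -(preK H) // -(preK K) // quotientS.
exists i, (L / Q)%G; split.
- by rewrite -(preK H) // quotient_normal.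
- apply/andP; split; first by rewrite -(preK K) // quotientS ?proper_sub.
  apply: contra (proper_subn pL) => sLK.
  have sLG : L \subset G by rewrite (subset_trans (normal_sub nL)) ?subsetIl.
  by rewrite subsetI sLG -sub_quotient_pre // (subset_trans sLG).
rewrite /= -(preK K) //; apply: pnat_dvd bL; apply: index_quotient.
apply: subset_trans nQ; apply: subset_trans (subsetIl _ _) _.
by apply: subset_trans (normal_sub nL) _; apply: subsetIl.
Qed.

(** Replacing [L] by the preimage of the whole core of [H / K] makes it canonical. For extensions,
    this carries normality from [M :&: H] up to [H]. *)
Lemma sigma_soluble_char c (gT : finGroupType) (G H K : {group gT}) :
  sigma_soluble c G -> H \subset G -> K <| H -> K \proper H ->
  exists i, exists X : {group gT},
    [/\ X \subset H, K \proper X, (block c i).-nat #|X : K|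
      & forall B : {group gT}, H <| B -> K <| B -> X <| B].
Proof.
move=> sol sHG nKH pKH.
have [i [L [nL pL bL]]] := sol H K sHG nKH pKH.
have nLK : L \subset 'N(K).
  by rewrite (subset_trans (normal_sub nL)) // normal_norm.
exists i, (coset K @*^-1 'O_(block c i)(H / K))%G; split.
- have := morphpreS (coset K) (pcore_sub (block c i) (H / K)).
  by rewrite quotientGK.
- apply: proper_sub_trans pL _.
  rewrite -sub_quotient_pre // pcore_max ?quotient_normal //.
  by rewrite /pgroup card_quotient.
- have -> : #|(coset K @*^-1 'O_(block c i)(H / K))%G : K|
      = #|'O_(block c i)(H / K)|.
    by rewrite -card_quotient ?cosetpreK // subsetIl.
  exact: pcore_pgroup.
move=> B nHB nKB; rewrite -(quotientGK nKB) cosetpre_normal.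
by apply: gFnormal_trans; apply: quotient_normal.
Qed.

(** If [M :&: H] lies in [K], then [H / K] is isomorphic to the section HM/KM of [G / M]. Otherwise
    [M :&: H] modulo its intersection with [K] is a nontrivial section of [M], and a primary piece
    [X] of it gives [X <*> K]. *)
Lemma sigma_soluble_extension c (gT : finGroupType) (G M : {group gT}) :
  M <| G -> sigma_soluble c M -> sigma_soluble c (G / M) ->
  sigma_soluble c G.
Proof.
move=> nM solM solQ H K sHG nKH pKH.
have nMH : M :&: H <| H by rewrite setIC; apply: normalGI nM.
have nH : H \subset 'N(M) by rewrite (subset_trans sHG) ?normal_norm.
have nK : K \subset 'N(M) by rewrite (subset_trans (normal_sub nKH)).
have [sMK | nsMK] := boolP (M :&: H \subset K).
  have eqHK : H :&: (M * K) = K.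
    by rewrite -group_modr ?normal_sub // setIC mulSGid.
  have [||| i [L [nL pL bL]]] := solQ (H / M)%G (K / M)%G.
  - exact: quotientS.
  - exact: quotient_normal.
  - rewrite properE (quotientS M (normal_sub nKH)) /=.
    apply: contra (proper_subn pKH) => /=.
    by rewrite quotientSK // => ?; rewrite -eqHK subsetI subxx.
  pose L1 := (coset M @*^-1 L)%G.
  have sML1 : M \subset L1 by apply: sub_cosetpre.
  have sL1 : L1 \subset M * H by rewrite -(quotientK nH) morphpreS ?normal_sub.
  have sKL1 : K \subset L1.
    have : coset M @*^-1 (K / M) \subset L1 by rewrite morphpreS // proper_sub.
    by apply: subset_trans; rewrite quotientK // mulG_subr.
  exists i, (H :&: L1)%G; split.
  - have nL1 : L1 <| coset M @*^-1 (H / M) by rewrite cosetpre_normal.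
    by apply: (normalGI _ nL1); rewrite /= quotientK // mulG_subr.
  - rewrite properE subsetI sKL1 normal_sub //=.
    apply: contra (proper_subn pL) => sLK.
    rewrite -(cosetpreK L) quotientSK ?subsetIl //=.
    have -> : coset M @*^-1 L = M * (H :&: L1).
      by rewrite group_modl //; apply/esym/setIidPr.
    exact: mulgS.
  have -> : #|(H :&: L1)%G : K| = #|(H :&: L1)%G : (coset M @*^-1 (K / M))%G|.
    rewrite -[RHS]indexgI; congr #|_ : _|.
    by rewrite /= quotientK // setIAC eqHK (setIidPl sKL1).
  rewrite -(index_cosetpre L (K / M)%G) in bL.
  apply: pnat_dvd bL; apply: dvdn_index_norm.
  - exact: subsetIr.
  - by rewrite morphpreS // proper_sub.
  right; apply: normal_norm.
  apply: normalS (_ : coset M @*^-1 (K / M) <| coset M @*^-1 (H / M)).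
  - by rewrite morphpreS // proper_sub.
  - by rewrite morphpreS // normal_sub.
  by rewrite cosetpre_normal quotient_normal.
have nMK : M :&: H :&: K <| M :&: H.
  by rewrite setIC setIC; apply: normalGI nKH; apply: subsetIr.
have [||| i [X [sX pX bX nX]]] :=
  @sigma_soluble_char _ _ _ (M :&: H)%G (M :&: H :&: K)%G solM => //.
- exact: subsetIl.
- by rewrite properE subsetIl /= subsetI subxx.
have nXH : X <| H by apply: nX => //=; apply: normalI.
exists i, (X <*> K)%G; split.
- exact: normalY.
- rewrite properE joing_subr join_subG subxx andbT.
  apply: contra (proper_subn pX) => sXK.
  by rewrite subsetI sX.
rewrite /= joingC norm_joinEr; last first.
  by rewrite (subset_trans (normal_sub nXH)) // normal_norm.
rewrite indexMg -indexgI; apply: pnat_dvd bX; apply: indexgS.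
by rewrite subsetI proper_sub //= subsetIr.
Qed.

(** For a prime [q] dividing [#|H : K|], the normal Hall subgroup [X] of the block of [q] works:
    [H :&: X] is not inside [K], since its index in [H] is prime to that block. *)
Lemma sigma_nilpotent_soluble c (gT : finGroupType) (G : {group gT}) :
  sigma_nilpotent c G 1 -> sigma_soluble c G.
Proof.
move=> nilG H K sHG nKH pKH.
have : pdiv #|H : K| \in \pi(#|H : K|).
  by rewrite pi_pdiv indexg_gt1 proper_subn.
set q := pdiv _ => qHK; have [X [nX _ pX pG]] := nilG (c q).
rewrite indexg1 in pX.
have nXH : H :&: X <| H by apply: normalGI nX.
exists (c q), ((H :&: X) <*> K)%G; split.
- exact: normalY.
- rewrite properE joing_subr join_subG subxx andbT.
  apply/negP => sXK.
  have /pnatPpi/(_ qHK) : (block c (c q))^'.-nat #|H : K|.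
    apply: (pnat_dvd (indexgS H sXK)); rewrite indexgI.
    apply: pnat_dvd pG; apply: dvdn_index_norm => //; first exact: normal_sub.
    by right; apply: normal_norm.
  by rewrite !inE eqxx.
rewrite /= joingC norm_joinEr; last first.
  by rewrite (subset_trans (normal_sub nXH)) // normal_norm.
rewrite indexMg; apply: pnat_dvd pX.
exact: dvdn_trans (dvdn_indexg _ _) (cardSg (subsetIr _ _)).
Qed.

Lemma sigma_metanilpotent_soluble c (gT : finGroupType) (G : {group gT}) :
  sigma_metanilpotent c G -> sigma_soluble c G.
Proof.
case=> N [nN nil1 nil2]; apply: (sigma_soluble_extension nN).
  exact: sigma_nilpotent_soluble.
apply: sigma_nilpotent_soluble => i; rewrite -(trivg_quotient N).
exact: nhall_quotient (normal_norm nN) (nil2 i).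
Qed.

(** * Wielandt's theorem for sigma-soluble subgroups *)

Lemma sigma_coprime_coprime c m n :
  0 < m -> 0 < n -> sigma_coprime c m n -> coprime m n.
Proof.
move=> m_gt0 n_gt0 co; rewrite coprime_has_primes //; apply/hasPn => q qn.
apply/negP => /= qm; have [] := co (c q).
  by move/pnatPpi => /(_ q qm); rewrite !inE eqxx.
by move/pnatPpi => /(_ q qn); rewrite !inE eqxx.
Qed.

Lemma exists_notin (I : finType) (X : {set I}) :
  #|X| < #|I| -> exists i, i \notin X.
Proof.
move=> ltXI; apply/existsP; rewrite -negb_forall; apply: contraL ltXI.
move/forallP => allX; rewrite -leqNgt -cardsT subset_leq_card //.
exact/subsetP.
Qed.

(* The argument of Wielandt's theorem on three soluble subgroups of pairwise
   coprime index: a nontrivial normal block-subgroup [N] of [A1] lies in some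
   [A2] (whose index avoids that block), and since [G = A2 * A1] the normal
   closure of [N] in [G] is still contained in [A2]. *)
Lemma sigma_soluble_index c (I : finType) (gT : finGroupType)
    (G : {group gT}) (A : I -> {group gT}) :
  2 < #|I| -> (forall i, A i \subset G) ->
  (forall i, sigma_soluble c (A i)) ->
  (forall i j, i != j -> sigma_coprime c #|G : A i| #|G : A j|) ->
  sigma_soluble c G.
Proof.
move=> cardI; move: {2}_.+1 (ltnSn #|G|) => n.
elim: n gT G A => // n IHn gT G A leGn sAG solA coA.
have coA' i j : i != j -> coprime #|G : A i| #|G : A j|.
  by move/coA/sigma_coprime_coprime; apply.
have [i1 _] : exists i, i \notin (set0 : {set I}).
  by apply: exists_notin; rewrite cards0 ltnW // ltnW.
(* If [A i1] is trivial, the index of any other member is coprime to the order of [G], so that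
   member is [G]. *)
have [A1 | ntA1] := eqVneq (A i1 : {set gT}) 1.
  have [i2] : exists i, i \notin [set i1].
    by apply: exists_notin; rewrite cards1 ltnW.
  rewrite inE => /coA'; rewrite A1 indexg1.
  rewrite -(Lagrange (sAG i2)) coprimeMr => /andP[_].
  rewrite /coprime gcdnn indexg_eq1 => sGA.
  exact: sigma_soluble_sub sGA (solA i2).
have [|| i [N [nN pN bN]]] := solA i1 (A i1) 1%G (subxx _).
- exact: normal1.
- by rewrite properE sub1G subG1.
rewrite indexg1 in bN.
(* Of two further members, at least one has index avoiding block [i]. *)
have [i2 ne12 p2] : exists2 i2, i2 != i1 & (block c i)^'.-nat #|G : A i2|.
  have [j] : exists i, i \notin [set i1].
    by apply: exists_notin; rewrite cards1 ltnW.
  rewrite inE => ne1j.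
  have [k] : exists i, i \notin [set i1; j].
    by apply: exists_notin; rewrite cards2; case: (_ != _) => //; rewrite ltnW.
  rewrite !inE negb_or => /andP[ne1k nejk].
  by have [] := coA _ _ nejk i => ?; [exists k | exists j].
have defG : A i2 * A i1 = G by apply: coprime_index_mulG => //; apply: coA'.
have sNA2 : N \subset A i2.
  suff : N \subset A i1 :&: A i2 by rewrite subsetI => /andP[].
  apply: (@sub_coprime_index (block c i) _ (A i1)); rewrite ?subsetIl //.
  - exact: normal_sub.
  - by left; apply: normal_norm.
  - by apply: pnat_dvd bN; apply: dvdn_indexg.
  by rewrite /= indexgI -indexMg defG.
(* The core of [A i2] in [G] contains [N], so it is nontrivial, and it is sigma-soluble as a
   subgroup of [A i2]; induction then handles [G / M]. *)
pose M := gcore_group (A i2) G.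
have nM : M <| G by apply: gcore_normal.
have sNM : N \subset M.
  apply/bigcapsP => g; rewrite -defG => /mulsgP[b a bA aA ->].
  rewrite conjsgM conjGid // -sub_conjgV.
  by rewrite (normsP (normal_norm nN)) ?groupV.
have solM : sigma_soluble c M := sigma_soluble_sub (gcore_sub _ _) (solA i2).
apply: (sigma_soluble_extension nM solM).
have nMA j : A j \subset 'N(M) := subset_trans (sAG j) (normal_norm nM).
apply: (IHn _ (G / M)%G (fun j => A j / M)%G).
- apply: leq_trans (ltn_quotient _ (normal_sub nM)) leGn.
  by apply: subG1_contra sNM _; rewrite -proper1G.
- by move=> j; apply: quotientS.
- by move=> j; apply: sigma_soluble_quotient.
move=> j k /coA co b; have := co b.
have dvd l : #|(G / M)%G : (A l / M)%G| %| #|G : A l|.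
  by apply: index_quotient; apply: subset_trans (subsetIr _ _) (nMA l).
by case=> p; [left | right]; apply: pnat_dvd p.
Qed.

(** * Cores, their centralizers and the quotient by a core *)

Lemma nhall1P (pi : nat_pred) (gT : finGroupType) (G : {group gT}) :
  nhall pi G 1 <-> pi.-Hall(G) 'O_pi(G).
Proof.
split=> [[K [nK _ pK pG]] | hallO].
  rewrite indexg1 in pK; have hallK : pi.-Hall(G) K.
    by apply/and3P; split; first exact: normal_sub.
  by rewrite (normal_Hall_pcore hallK).
have [sO pO pG] := and3P hallO.
exists 'O_pi(G)%G; split; rewrite ?sub1G ?indexg1 //.
exact: pcore_normal.
Qed.

Lemma normal_coprime_cent (gT : finGroupType) (G H K : {group gT}) :
  H <| G -> K <| G -> coprime #|H| #|K| -> H \subset 'C(K).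
Proof.
move=> nH nK co; apply/commG1P/trivgP; rewrite -(coprime_TIg co).
apply: commg_subI; rewrite subsetI subxx /=.
  exact: subset_trans (normal_sub nH) (normal_norm nK).
exact: subset_trans (normal_sub nK) (normal_norm nH).
Qed.

(* Hall-Higman: with [V] the core, a sigma-primary section just above
   [V :&: 'C_G(V)] in ['C_G(V)] would give a normal b-subgroup outside [V] or,
   by Schur-Zassenhaus, a nontrivial normal b'-subgroup. *)
Lemma sigma_soluble_cent_pcore c i (gT : finGroupType) (G : {group gT}) :
  sigma_soluble c G -> 'O_(block c i)^'(G) = 1 ->
  'C_G('O_(block c i)(G)) \subset 'O_(block c i)(G).
Proof.
set pi := block c i => sol O1; apply/idPn => nsCV.
pose V := 'O_pi(G)%G; pose C := 'C_G(V)%G; pose Z := (C :&: V)%G.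
have nCG : C <| G.
  by have := subcent_normal G V; rewrite (setIidPl (gFnorm _ _)).
have nZC : Z <| C.
  by apply: normalGI (pcore_normal pi G); apply: normal_sub.
have pZC : Z \proper C by rewrite properE subsetIl subsetI subxx.
have [j [L [nL pL bL]]] := sol C Z (normal_sub nCG) nZC pZC.
have sLC := normal_sub nL.
have pZ : pi.-group Z := pgroupS (subsetIr _ _) (pcore_pgroup pi G).
have [eqji | neji] := eqVneq j i.
  have piL : pi.-group L.
    by rewrite /pgroup -(Lagrange (proper_sub pL)) pnatM /pi -{2}eqji bL andbT.
  have sLO : L \subset 'O_pi(G).
    exact: subset_trans (pcore_max piL nL) (pcore_normal_sub pi nCG).
  by case/negP: (proper_subn pL); rewrite subsetI sLC.
have p'L : pi^'.-nat #|L : Z|.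
  apply: sub_in_pnat bL => q _; rewrite !inE => /eqP->.
  exact: neji.
have nZL : Z <| L by apply: normalS nZC => //; apply: proper_sub.
have hallZ : Hall L Z.
  by rewrite /Hall normal_sub //= (pnat_coprime pZ).
have /splitsP[K /complP[tiZK defL]] := SchurZassenhaus_split hallZ nZL.
have sKL : K \subset L by rewrite -defL mulG_subr.
(* Lying in [C], the complement [K] centralizes [Z]; hence it is normal in [L = Z * K] and falls
   into the trivial core of [G]. *)
have cKZ : K \subset 'C(Z).
  have sKV : K \subset 'C(V).
    by apply: subset_trans sKL (subset_trans sLC (subsetIr _ _)).
  by apply: subset_trans sKV (centS (subsetIr _ _)).
have nKL : K <| L.
  rewrite /normal sKL -defL mul_subG ?normG //.
  by rewrite cents_norm // centsC.
have pK : pi^'.-group K.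
  rewrite /pgroup; suff <- : #|L : Z| = #|K| by [].
  by rewrite -defL indexMg -indexgI setIC tiZK indexg1.
have K1 : K :=: 1.
  apply/trivgP; rewrite -O1; apply: subset_trans (pcore_max pK nKL) _.
  exact: subset_trans (pcore_normal_sub _ nL) (pcore_normal_sub _ nCG).
by move: (proper_subn pL); rewrite -defL K1 mulg1 subxx.
Qed.

Lemma sigma_metanilpotent_over_pcore c i (gT : finGroupType)
    (G A : {group gT}) :
  'C_G('O_(block c i)(G)) \subset 'O_(block c i)(G) ->
  A \subset G -> (block c i)^'.-nat #|G : A| -> sigma_metanilpotent c A ->
  'O_(block c i)(G) \subset A /\ exists N : {group gT},
    [/\ N <| A, (block c i).-group N, sigma_nilpotent c A N
      & nhall (block c i) A 1].
Proof.
set pi := block c i => sCV sAG piA [N [nN nilN nilA]].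
pose V := 'O_pi(G)%G.
have sVA : V \subset A.
  apply: (@sub_coprime_index pi _ G) => //; first exact: pcore_sub.
    by left; apply: gFnorm.
  exact: pnat_dvd (dvdn_indexg _ _) (pcore_pgroup _ _).
have nVA : V <| A by apply: normalS sVA sAG (pcore_normal _ _).
split=> //.
have pN : pi.-group N.
  apply/pgroupP => q q_pr qN.
  have := nilN (c q); case/nhall1P/and3P=> _ pX.
  pose X := 'O_(block c (c q))(N)%G => p'N.
  rewrite !inE; apply/idPn => neqi.
  have nXA : X <| A by apply: gFnormal_trans.
  have coXV : coprime #|X| #|V|.
    rewrite coprime_sym; apply: pnat_coprime (pcore_pgroup _ _) _.
    by apply: sub_in_pnat pX => r _; rewrite !inE => /eqP->.
  have sXC : X \subset 'C_G(V).
    rewrite subsetI (subset_trans (normal_sub nXA)) //.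
    exact: normal_coprime_cent nXA nVA coXV.
  have X1 : X :=: 1.
    have sXV : X \subset V := subset_trans sXC sCV.
    by rewrite -(setIidPl sXV) coprime_TIg.
  move: p'N; rewrite /= X1 indexg1 => /pgroupP/(_ q q_pr qN).
  by rewrite !inE eqxx.
exists N; split=> //.
have [K [nK sNK pK pA]] := nilA i.
exists K; split; rewrite ?sub1G //.
by rewrite indexg1 -(Lagrange sNK) pnatM pK andbT.
Qed.

Lemma sigma_metanilpotent_index_pcore c i (I : finType) (gT : finGroupType)
    (G : {group gT}) (A : I -> {group gT}) :
  3 < #|I| -> (forall j, A j \subset G) ->
  (forall j, sigma_metanilpotent c (A j)) ->
  (forall j k, j != k -> sigma_coprime c #|G : A j| #|G : A k|) ->
  'O_(block c i)^'(G) = 1 ->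
  sigma_nilpotent c G 'O_(block c i)(G).
Proof.
set pi := block c i => cardI sAG metaA coA O1.
pose V := 'O_pi(G)%G; pose bad l := [set j | ~~ (block c l)^'.-nat #|G : A j|].
have card_bad l : #|bad l| <= 1.
  apply/card_le1_eqP => j k; rewrite !inE => badj badk; apply/eqP/idPn.
  by case/coA/(_ l) => pl; rewrite pl in badj badk.
(* At most one index involves block [i] and at most one block [l], so four members leave two that
   avoid both. *)
have good_pair l : exists j k, [/\ j != k,
    pi^'.-nat #|G : A j|, pi^'.-nat #|G : A k|,
    (block c l)^'.-nat #|G : A j| & (block c l)^'.-nat #|G : A k|].
  have cardX : #|bad i :|: bad l| <= 2.
    by rewrite (leq_trans (leq_card_setU _ _)) // (leq_add (card_bad i)).
  have [j jX] := exists_notin (leq_ltn_trans cardX (ltnW cardI)).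
  have [|k] := @exists_notin I (j |: (bad i :|: bad l)).
    by rewrite cardsU1 jX (leq_ltn_trans _ cardI).
  move: jX; rewrite !inE !negb_or !negbK => /andP[ji jl] /and3P[nejk ki kl].
  by exists j, k; split; rewrite // eq_sym.
have coA' j k : j != k -> coprime #|G : A j| #|G : A k|.
  by move/coA/sigma_coprime_coprime; apply.
have sCV : 'C_G(V) \subset V.
  apply: sigma_soluble_cent_pcore => //.
  apply: (sigma_soluble_index (ltnW cardI) sAG) => // j.
  exact: sigma_metanilpotent_soluble.
have over j pj := sigma_metanilpotent_over_pcore sCV (sAG j) pj (metaA j).
have pV : pi^'.-nat #|G : V|.
  have [j [k [nejk pj pk _ _]]] := good_pair i.
  have [_ [Nj [_ _ _ hj]]] := over j pj.
  have [_ [Nk [_ _ _ hk]]] := over k pk.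
  have := nhall_coprime_index (V := 1%G) (sAG j) (sAG k) (coA' j k nejk)
    (sub1G _) (sub1G _) pj pk hj hk.
  by case/nhall1P/and3P.
move=> l; have [j [k [nejk pj pk lj lk]]] := good_pair l.
have hallV m : pi^'.-nat #|G : A m| ->
    V \subset A m /\ nhall (block c l) (A m) V.
  move=> pm; have [sVA [N [nN pN nilA _]]] := over m pm; split=> //.
  apply: nhall_mono (nilA l).
    (* By [pV], the core [V] is a normal Hall subgroup, so it contains the pi-group [N]. *)
    apply: (@sub_coprime_index pi _ G) => //.
    - exact: subset_trans (normal_sub nN) (sAG m).
    - exact: pcore_sub.
    - by right; apply: gFnorm.
    exact: pnat_dvd (dvdn_indexg _ _) pN.
  exact: normalS sVA (sAG m) (pcore_normal _ _).
have [[sVj hj] [sVk hk]] := (hallV j pj, hallV k pk).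
exact: nhall_coprime_index (coA' j k nejk) sVj sVk lj lk hj hk.
Qed.

(** [L] is the second term O_{b',b}(G): the previous lemma applies to the quotient by the b'-core,
    which is itself the normal Hall b'-subgroup of [L]. *)
Lemma sigma_metanilpotent_index_local c i (I : finType) (gT : finGroupType)
    (G : {group gT}) (A : I -> {group gT}) :
  3 < #|I| -> (forall j, A j \subset G) ->
  (forall j, sigma_metanilpotent c (A j)) ->
  (forall j k, j != k -> sigma_coprime c #|G : A j| #|G : A k|) ->
  exists L : {group gT},
    [/\ L <| G, sigma_nilpotent c G L & nhall (block c i)^' L 1].
Proof.
move=> cardI sAG metaA coA; set pi := block c i.
pose Q := 'O_pi^'(G)%G; have nQ : Q <| G by apply: pcore_normal.
have nQA j : A j \subset 'N(Q) := subset_trans (sAG j) (normal_norm nQ).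
have nilQ : sigma_nilpotent c (G / Q) 'O_pi(G / Q).
  apply: (sigma_metanilpotent_index_pcore (A := fun j => A j / Q)%G) => //=.
  - by move=> j; apply: quotientS.
  - by move=> j; apply: sigma_metanilpotent_quotient.
  - move=> j k /coA co b; have := co b.
    have dvd l : #|(G / Q)%G : (A l / Q)%G| %| #|G : A l|.
      by apply: index_quotient; apply: subset_trans (subsetIr _ _) (nQA l).
    by case=> p; [left | right]; apply: pnat_dvd (dvd _) p.
  exact: trivg_pcore_quotient.
pose L := (coset Q @*^-1 'O_pi(G / Q))%G.
have sQL : Q \subset L by apply: sub_cosetpre.
exists L; split.
- by rewrite -(quotientGK nQ) cosetpre_normal pcore_normal.
- by move=> l; apply: nhall_cosetpre (nilQ l).
exists Q; split; rewrite ?sub1G //.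
- by rewrite /normal sQL subsetIl.
- by rewrite indexg1; apply: pcore_pgroup.
rewrite -card_quotient ?subsetIl //= cosetpreK pnatNK.
exact: pcore_pgroup.
Qed.

(** * Gluing over all blocks *)

(** Serves twice: to intersect normal Hall subgroups over the blocks, and to intersect the subgroups
    [L] obtained from each block. *)
Lemma finite_meet_subgroup (gT : finGroupType) (G : {group gT})
    (P : {group gT} -> Prop) (Q : nat -> {group gT} -> Prop) (r : seq nat) :
  P G -> (forall H K, P H -> P K -> P (H :&: K)%G) ->
  (forall i (H K : {group gT}), H \subset K -> Q i K -> Q i H) ->
  (forall i, i \in r -> exists2 H, P H & Q i H) ->
  exists2 H, P H & forall i, i \in r -> Q i H.
Proof.
move=> PG PI QS; elim: r => [|i r IHr] exH; first by exists G.
have [|H PH QH] := IHr; first by move=> j jr; apply: exH; rewrite inE jr orbT.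
have [K PK QK] := exH i (mem_head i r).
exists (H :&: K)%G => [|j]; first exact: PI.
rewrite inE => /predU1P[-> | jr]; first exact: QS (subsetIr _ _) QK.
by apply: QS (QH j jr); apply: subsetIl.
Qed.

Lemma pnat_block' c i n :
  0 < n -> i \notin [seq c q | q <- primes n] -> (block c i)^'.-nat n.
Proof.
move=> n_gt0 /mapP nqi; apply/pnatP => // q q_pr qn.
rewrite !inE; apply/eqP => cqi; case: nqi; exists q => //.
by rewrite mem_primes q_pr n_gt0.
Qed.

(** Intersect the normal Hall subgroups for the complements of all blocks other than [i]: each index
    avoids block [i], and the order of the intersection keeps only primes of block [i]. *)
Lemma sigma_nilpotent_dual c (gT : finGroupType) (G : {group gT}) :
  (forall i, nhall (block c i)^' G 1) -> sigma_nilpotent c G 1.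
Proof.
move=> dualG i; pose r := [seq c q | q <- primes #|G|].
have [|||j _|K [nK pK] pr] := @finite_meet_subgroup _ G
    (fun K => K <| G /\ (block c i)^'.-nat #|G : K|)
    (* The guard lets [r] contain [i], for which [G] itself is the witness. *)
    (fun j K => j != i -> (block c j)^'.-nat #|K|) r.
- by rewrite indexgg.
- move=> H K [nH pH] [nK pK]; split; first exact: normalI.
  rewrite -(@Lagrange_index _ G H (H :&: K)%G) ?subsetIl ?(normal_sub nH) //=.
  rewrite pnatM pH indexgI; apply: pnat_dvd pK.
  by apply: dvdn_index_norm; [apply: normal_sub..|left; apply: normal_norm].
- by move=> j H K sHK pK nej; apply: pnat_dvd (cardSg sHK) (pK nej).
- have [-> | nej] := eqVneq j i; first by exists G; rewrite // indexgg.
  have [K [nK _]] := dualG j; rewrite indexg1 pnatNK => pK pG.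
  exists K => //; split=> //; apply: sub_in_pnat pG => q _.
  by rewrite !inE => /eqP->.
exists K; split; rewrite ?sub1G // indexg1.
apply/pgroupP => q q_pr qK; rewrite !inE; apply/idPn => nei.
have qG : q %| #|G| := dvdn_trans qK (cardSg (normal_sub nK)).
have cqr : c q \in r by rewrite map_f // mem_primes q_pr cardG_gt0.
have /pgroupP/(_ q q_pr qK) := pr _ cqr nei.
by rewrite !inE eqxx.
Qed.

Lemma sigma_metanilpotent_index c (I : finType) (gT : finGroupType)
    (G : {group gT}) (A : I -> {group gT}) :
  3 < #|I| -> (forall j, A j \subset G) ->
  (forall j, sigma_metanilpotent c (A j)) ->
  (forall j k, j != k -> sigma_coprime c #|G : A j| #|G : A k|) ->
  sigma_metanilpotent c G.
Proof.
move=> cardI sAG metaA coA; pose r := [seq c q | q <- primes #|G|].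
have [|||i _|F [nF nilF] dualF] := @finite_meet_subgroup _ G
    (fun L => L <| G /\ sigma_nilpotent c G L)
    (fun i L => nhall (block c i)^' L 1) r.
- split=> // i; exists G; split=> //; rewrite indexgg //.
- move=> H K [nH hH] [nK hK]; split; first exact: normalI.
  by move=> i; apply: nhall_setI.
- move=> i H K sHK [C [nC _ pC pK]]; exists (H :&: C)%G; split.
  + exact: normalGI nC.
  + exact: sub1G.
  + rewrite indexg1; rewrite indexg1 in pC.
    exact: pnat_dvd (cardSg (subsetIr H C)) pC.
  rewrite indexgI; apply: pnat_dvd pK; apply: dvdn_index_norm => //.
    exact: normal_sub.
  by right; apply: normal_norm.
- have [L [nL nilL dualL]] :=
    sigma_metanilpotent_index_local i cardI sAG metaA coA.
  by exists L.
exists F; split=> //; apply: sigma_nilpotent_dual => i.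
(* A colour outside [r] is taken by no prime divisor of the order of [G], so [F] is its own Hall
   subgroup. *)
have [/dualF // | ir] := boolP (i \in r).
exists F; split; rewrite ?sub1G ?indexgg // indexg1.
by apply: pnat_dvd (cardSg (normal_sub nF)) _; apply: pnat_block'.
Qed.

(** * From pi-special to sigma-nilpotent and back *)

(* The primes outside [s] get the common colour 0, which is not prime. *)
Definition colour (s : seq nat) (p : nat) : nat := if p \in s then p else 0.

Lemma block_in s p :
  0 \notin s -> p \in s -> block (colour s) p =i (p : nat_pred).
Proof.
move=> s0 ps q; rewrite !inE /colour; case: ifP => // qs.
have [eqp | _] := eqVneq 0 p; first by rewrite eqp ps in s0.
by apply/esym/negP => /eqP eqp; rewrite eqp ps in qs.
Qed.

Lemma block_compl s : 0 \notin s -> block (colour s) 0 =i (prime_set s)^'.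
Proof.
move=> s0 q; rewrite !inE /colour.
have -> : (q \in prime_set s) = (q \in s) by [].
case: ifP => [qs | _]; last by rewrite eqxx.
by apply/negP => /eqP q0; rewrite -q0 qs in s0.
Qed.

Lemma block_out s i : i \notin s -> i != 0 -> block (colour s) i =i pred0.
Proof.
move=> si i0 q; rewrite !inE /colour; case: ifP => [qs | _].
  by apply/negP => /eqP qi; rewrite -qi qs in si.
by rewrite eq_sym (negbTE i0).
Qed.

(** Only orders matter: the order of [G] is the product of those of the cores, so the index of one
    core is the product of the orders of the others. *)
Lemma pi_special_sigma_nilpotent s (gT : finGroupType) (G : {group gT}) :
  uniq s -> 0 \notin s ->
  pi_special s G -> sigma_nilpotent (colour s) G 1.
Proof.
move=> s_uniq s0 specG i.
have oG : (\prod_(p <- s) #|'O_p(G)| * #|'O_(prime_set s)^'(G)| = #|G|)%N.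
  rewrite -(dprod_card specG); case/dprodP: specG => [[K H eqK _] _ _ _].
  by rewrite eqK (bigdprod_card eqK).
have idx (rho : nat_pred) m : (#|'O_rho(G)| * m = #|G|)%N ->
    #|G : 'O_rho(G)| = m.
  move=> oG'; apply/eqP; rewrite -(eqn_pmul2l (cardG_gt0 'O_rho(G)%G)).
  by rewrite Lagrange ?pcore_sub // oG'.
have pcoreP (rho : nat_pred) : rho.-nat #|'O_rho(G)| := pcore_pgroup rho G.
apply/nhall1P; rewrite /pHall pcore_sub pcore_pgroup /=.
have [is_ | nis] := boolP (i \in s).
  rewrite (eq_pcore G (block_in s0 is_)).
  rewrite (eq_pnat _ (eq_negn (block_in s0 is_))).
  rewrite (bigD1_seq i) //= -mulnA in oG; rewrite (idx _ _ oG) pnatM.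
  apply/andP; split.
    apply: (big_ind (fun n => i^'.-nat n)) => // [m n pm pn | q nqi].
      by rewrite pnatM pm.
    by apply: sub_in_pnat (pcoreP q) => r _; rewrite !inE => /eqP->.
  apply: sub_in_pnat (pcoreP _) => r _; rewrite !inE.
  by apply: contraNneq => ->.
have [-> | nei0] := eqVneq i 0.
  rewrite (eq_pcore G (block_compl s0)).
  rewrite (eq_pnat _ (eq_negn (block_compl s0))).
  rewrite mulnC in oG; rewrite (idx _ _ oG) pnatNK big_seq.
  apply: (big_ind (fun n => (prime_set s).-nat n)) => // [m n pm pn | q qs].
    by rewrite pnatM pm.
  by apply: sub_in_pnat (pcoreP q) => r _; rewrite !inE => /eqP->.
apply/pnatP => // q _ _; rewrite inE /= (block_out nis nei0) //.
Qed.

(** Cores of distinct blocks have coprime orders, so their product [M] is direct. Each prime lies in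
    a block whose core is a Hall subgroup inside [M], so no prime divides [#|G : M|]. *)
Lemma sigma_nilpotent_pi_special s (gT : finGroupType) (G : {group gT}) :
  uniq s -> 0 \notin s ->
  sigma_nilpotent (colour s) G 1 -> pi_special s G.
Proof.
move=> s_uniq s0 nilG.
have [K [defK nK pK sK]] : exists K : {group gT},
    [/\ \big[dprod/1]_(p <- s) 'O_p(G) = K, K <| G, (prime_set s).-group K
      & forall p, p \in s -> 'O_p(G) \subset K].
  elim: s s_uniq {s0 nilG} => [_ | p t IHt /=].
    by exists 1%G; rewrite big_nil; split; rewrite ?normal1 ?pgroup1.
  case/andP=> pt /IHt[K [defK nK pK sK]].
  have nO := pcore_normal p G.
  have co : coprime #|'O_p(G)| #|K|.
    apply: pnat_coprime (pcore_pgroup p G) _.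
    apply: sub_in_pnat pK => q _ qt; rewrite !inE.
    by apply: contraNneq pt => <-.
  have cKO : K \subset 'C('O_p(G)).
    by rewrite centsC (normal_coprime_cent nO nK).
  exists ('O_p(G) <*> K)%G; split.
  - by rewrite big_cons defK dprodEY // coprime_TIg.
  - exact: normalY.
  - rewrite /= cent_joinEr // pgroupM.
    apply/andP; split.
      by apply: sub_in_pnat (pcore_pgroup p G) => q _; rewrite !inE => ->.
    by apply: sub_in_pnat pK => q _ qt; rewrite !inE [q \in t]qt orbT.
  move=> q; rewrite inE => /predU1P[-> | qt]; first exact: joing_subl.
  by apply: subset_trans (sK q qt) _; apply: joing_subr.
have nO := pcore_normal (prime_set s)^' G.
rewrite /pi_special defK dprodEY /=; last 2 first.
- rewrite centsC; apply: (normal_coprime_cent nK nO).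
  exact: pnat_coprime pK (pcore_pgroup _ _).
- by apply: coprime_TIg; apply: pnat_coprime pK (pcore_pgroup _ _).
pose M := (K <*> 'O_(prime_set s)^'(G))%G.
apply/eqP; rewrite -/(gval M) eqEsubset.
have sMG : M \subset G by rewrite join_subG !normal_sub.
rewrite sMG -indexg_eq1 /=; apply/eqP/(@pnat_1 pred0); last first.
  exact/pnatP.
apply/pnatP => // q q_pr qM.
have absurd (H : {group gT}) j : H :=: 'O_(block (colour s) j)(G) ->
    H \subset M -> q \notin block (colour s) j.
  move=> defH sHM; have /nhall1P/and3P[_ _] := nilG j; rewrite -defH.
  by move/pnatP; apply=> //; apply: dvdn_trans qM (indexgS G sHM).
have [qs | nqs] := boolP (q \in s).
  have /negP[] := absurd 'O_q(G)%G q (esym (eq_pcore G (block_in s0 qs)))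
    (subset_trans (sK q qs) (joing_subl _ _)).
  by rewrite block_in // inE.
have /negP[] := absurd 'O_(prime_set s)^'(G)%G 0
  (esym (eq_pcore G (block_compl s0))) (joing_subr _ _).
by rewrite block_compl.
Qed.

Lemma meta_pi_special_sigma s (gT : finGroupType) (G : {group gT}) :
  uniq s -> 0 \notin s ->
  meta_pi_special s G <-> sigma_metanilpotent (colour s) G.
Proof.
move=> s_uniq s0; split=> [] [N [nN spN spQ]]; exists N; split=> //.
- exact: pi_special_sigma_nilpotent.
- move=> i; have nilQ := pi_special_sigma_nilpotent s_uniq s0 spQ i.
  by have := nhall_cosetpre (M := 1%G) nN nilQ; rewrite -kerE ker_coset.
- exact: sigma_nilpotent_pi_special.
apply: sigma_nilpotent_pi_special => // i; rewrite -(trivg_quotient N).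
exact: nhall_quotient (normal_norm nN) (spQ i).
Qed.

Theorem corollary1p9 (s : seq nat) (gT : finGroupType) (G : {group gT})
    (A : 'I_4 -> {group gT})
    (s_uniq : uniq s)
    (s_prime : forall p : nat, p \in s -> prime p)
    (sAG : forall i : 'I_4, A i \subset G)
    (A_meta : forall i : 'I_4, meta_pi_special s (A i))
    (A_coprime : forall i j : 'I_4,
       i != j -> coprime #|G : A i| #|G : A j|)
    (A_index : forall i : 'I_4,
       (prime_set s).-nat #|G : A i| || (prime_set s)^'.-nat #|G : A i|)
    (A_index' : #|[set i : 'I_4 | (prime_set s)^'.-nat #|G : A i|]| <= 1) :
  meta_pi_special s G.
Proof.
have s0 : 0 \notin s by apply/negP => /s_prime.
apply/meta_pi_special_sigma => //.
apply: (@sigma_metanilpotent_index _ 'I_4 _ _ A); rewrite ?card_ord //.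
  by move=> j; apply/meta_pi_special_sigma.
move=> j k nejk l; have [ls | nls] := boolP (l \in s).
  rewrite !(eq_pnat _ (eq_negn (block_in s0 ls))).
  rewrite !p'natE ?s_prime //; apply/orP; rewrite -negb_and.
  apply/negP => /andP[lj lk].
  have := dvdn_gcd l #|G : A j| #|G : A k|; rewrite lj lk.
  rewrite (eqP (A_coprime j k nejk)) dvdn1 => /eqP l1.
  by have := s_prime l ls; rewrite l1.
have [-> | nel0] := eqVneq l 0.
  (* An index that is not a pi-number is a pi'-number by [A_index], and [A_index'] allows only one
     such member. *)
  rewrite !(eq_pnat _ (eq_negn (block_compl s0))) !pnatNK; apply/orP.
  apply: contraR nejk; rewrite negb_or => /andP[nj nk].
  apply/eqP/(card_le1_eqP A_index'); rewrite inE.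
    by have := A_index k; rewrite (negbTE nk).
  by have := A_index j; rewrite (negbTE nj).
by left; apply/pnatP => // q _ _; rewrite inE /= (block_out nls nel0).
Qed.
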